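(* Let $M=m^{2}$ with $m\in(0,\pi)$, and set $$g(M)=-\frac{m^{2}\cos\left(\frac m2\right)}{1-\cos\left(\frac m2\right)},\qquad k(M)=-m^2\cot^2\left(\tfrac m2\right).$$ Let $\delta_2\in(g(M),M)$ and $\delta_1\in\mathbb{R}$. Then: 1. If $\delta_2\in(k(M),M)$, then $G_{M,\delta_1,\delta_2}$ is strictly positive on $[0,1]\times[0,1]$ if and only if $|\delta_1|<m\cot\left(\frac m2\right)$. 2. If $\delta_2\in(g(M),k(M)]$, then $G_{M,\delta_1,\delta_2}$ is strictly positive on $[0,1]\times[0,1]$ if and only if $$|\delta_1|<\frac{\sqrt{-\delta_2^{2}+\cos^{2}\left(\frac m2\right)\left(m^{2}-\delta_2\right)^{2}}}{m}.$$
   Context: Let $I=[0,1]$. For real parameters $M,\delta_1,\delta_2$ consider the problem $$u''(t)+M\,u(t)=\sigma(t),\ t\in I,\qquad u(0)-u(1)=\delta_1\int_0^1u(s)\,ds,\qquad u'(0)-u'(1)=\delta_2\int_0^1u(s)\,ds,$$ with $\sigma\in C(I)$. If this problem has a unique solution $u\in C^2(I)$ for every $\sigma\in C(I)$ (this happens exactly when $\delta_2\ne M$ and $M\neq 4k^2\pi^2$ for all integers $k\ge 1$), its Green's function $G_{M,\delta_1,\delta_2}$ is the unique continuous function on $I\times I$ such that for every $\sigma\in C(I)$ the unique solution is $u(t)=\int_0^1G_{M,\delta_1,\delta_2}(t,s)\,\sigma(s)\,ds$. For $M\in(0,\pi^2)$ one has $g(M)<k(M)<M$. *)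

(* Defs.v *)
From Stdlib Require Import Reals.
From Coquelicot Require Import Coquelicot.
Open Scope R_scope.

Definition unitI (t : R) : Prop := 0 <= t <= 1.

Definition cot (x : R) : R := cos x / sin x.

(* The functions u, du, d2u are only constrained on [0,1]: [D_in] is the
   derivative relative to the set [unitI], hence one-sided at 0 and 1, so that
   the first two conditions say that u is in C^2([0,1]). *)
Definition is_solution (M delta1 delta2 : R) (sigma u : R -> R) : Prop :=
  exists du d2u : R -> R,
    (forall t, unitI t -> D_in u du unitI t /\ D_in du d2u unitI t) /\
    continuous_on unitI d2u /\
    (forall t, unitI t -> d2u t + M * u t = sigma t) /\
    u 0 - u 1 = delta1 * RInt u 0 1 /\
    du 0 - du 1 = delta2 * RInt u 0 1.

(* Unique solvability for every continuous sigma is part of the definition. *)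
Definition is_green_function (M delta1 delta2 : R) (G : R -> R -> R) : Prop :=
  continuous_on (fun p : R * R => unitI (fst p) /\ unitI (snd p))
                (fun p : R * R => G (fst p) (snd p)) /\
  forall sigma : R -> R, continuous_on unitI sigma ->
    is_solution M delta1 delta2 sigma
      (fun t => RInt (fun s => G t s * sigma s) 0 1) /\
    forall v : R -> R, is_solution M delta1 delta2 sigma v ->
      forall t, unitI t -> v t = RInt (fun s => G t s * sigma s) 0 1.

Definition strictly_positive_on_square (G : R -> R -> R) : Prop :=
  forall t s, unitI t -> unitI s -> 0 < G t s.

(* The thresholds g(M) and k(M), as functions of m where M = m^2. *)
Definition g_threshold (m : R) : R :=
  - (m ^ 2 * cos (m / 2) / (1 - cos (m / 2))).

Definition k_threshold (m : R) : R := - (m ^ 2 * (cot (m / 2)) ^ 2).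

(* Main.v *)
Require Import Defs.
From Stdlib Require Import Reals Lra.
From Coquelicot Require Import Coquelicot.
Open Scope R_scope.

(** The Green's function can be written down. Put [th = m (1/2 - t)]. Up to the
positive factor [2 m sin (m/2)] it is
[cos (m (1/2 - |t - s|)) + (d1 m sin th + d2 cos th) / (m^2 - d2)]:
the first term is the periodic Green's function, and the second one solves the
homogeneous equation and corrects the boundary jumps, the integral of [u] being
[(int sigma) / (m^2 - d2)].

That a given Green's function [G] must be this one is shown by pairing.
Integrating the formula against [sigma = u'' + m^2 u] by parts, separately on the
two sides of the diagonal, returns [u t] for every solution [u]
([green_represents]). Hence [G t] and the formula have the same integrals against
every continuous [sigma], and taking [sigma] to be their difference shows that
they agree ([green_function_unique]).

As a function of [s], the formula is smallest on the diagonal [s = t], because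
[m < PI]. So positivity on the square says that the sinusoid
[d1 m sin th + d2 cos th] stays above [- (m^2 - d2) cos (m/2)] for all [th] in
[[-m/2, m/2]] ([green_positive_iff]). The threshold for [d1] depends on where the
sinusoid has its minimum. If [d2] is above [k(M)], the two endpoints [th = m/2] and
[th = - m/2] are decisive, and they give [|d1| < m cot (m/2)]
([diagonal_positive_iff_endpoints]). If [d2] is at most [k(M)], the endpoint
conditions force the global minimum of the sinusoid,
[- sqrt (d1^2 m^2 + d2^2)], to be attained inside the interval, and this value is
decisive ([diagonal_positive_iff_interior]). *)

(** * Functions given on the unit interval *)

(** Composing with the projection onto [[0, 1]] turns data given on [[0, 1]] only
into functions that are continuous on the whole line, so that no one-sided limits
or derivatives remain. *)
Definition clamp (x : R) : R := Rmax 0 (Rmin 1 x).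

Lemma clamp_unitI (x : R) : unitI (clamp x).
Proof.
  unfold unitI, clamp, Rmax, Rmin.
  destruct (Rle_dec 1 x); destruct (Rle_dec 0 _); lra.
Qed.

Lemma clamp_id (x : R) : unitI x -> clamp x = x.
Proof.
  unfold unitI, clamp, Rmax, Rmin; intros H.
  destruct (Rle_dec 1 x); destruct (Rle_dec 0 _); lra.
Qed.

Lemma clamp_contracts (x y : R) : Rabs (clamp x - clamp y) <= Rabs (x - y).
Proof.
  unfold clamp, Rmax, Rmin.
  destruct (Rle_dec 1 x); destruct (Rle_dec 1 y);
    repeat destruct (Rle_dec 0 _); unfold Rabs; repeat destruct (Rcase_abs _); lra.
Qed.

Lemma continuous_clamp_comp (f : R -> R) :
  continuous_on unitI f -> forall x, continuous (fun y => f (clamp y)) x.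
Proof.
  intros Hf x.
  apply (filterlim_comp _ _ _ clamp f _ (within unitI (locally (clamp x)))).
  - intros P [eps He]; exists eps; intros y Hy.
    apply He; [|apply clamp_unitI].
    exact (Rle_lt_trans _ _ _ (clamp_contracts y x) Hy).
  - exact (Hf _ (clamp_unitI x)).
Qed.

Lemma continuous_continuous_on (D : R -> Prop) (f : R -> R) :
  (forall x, continuous f x) -> continuous_on D f.
Proof.
  intros Hf x _ P HP.
  destruct (Hf x P HP) as [eps He]; exists eps; intros y Hy _; exact (He y Hy).
Qed.

Lemma D_in_continuous_on (f df : R -> R) (D : R -> Prop) :
  (forall t, D t -> D_in f df D t) -> continuous_on D f.
Proof.
  intros Hd x Dx P [eps He].
  destruct (cont_deriv _ _ _ _ (Hd x Dx) eps (cond_pos eps)) as [del [Hdel Hlim]].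
  exists (mkposreal del Hdel); intros y Hy Dy; apply He.
  destruct (Req_dec y x) as [->|Hne]; [apply ball_center|].
  apply Hlim; repeat split; auto.
Qed.

Lemma D_in_clamp_is_derive (f df : R -> R) (t : R) :
  D_in f df unitI t -> 0 < t < 1 ->
  is_derive (fun x => f (clamp x)) t (df (clamp t)).
Proof.
  intros Hd Ht.
  assert (Hr : 0 < Rmin t (1 - t)) by (apply Rmin_pos; lra).
  rewrite clamp_id by (unfold unitI; lra).
  apply (is_derive_ext_loc f).
  - exists (mkposreal _ Hr); intros y Hy.
    rewrite clamp_id; [reflexivity|].
    apply Rabs_def2 in Hy; simpl in Hy; unfold minus, plus, opp in Hy; simpl in Hy.
    generalize (Rmin_l t (1 - t)) (Rmin_r t (1 - t)); unfold unitI; lra.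
  - apply is_derive_Reals; intros eps Heps.
    destruct (Hd eps Heps) as [del [Hdel Hlim]].
    exists (mkposreal _ (Rmin_pos _ _ Hdel Hr)); simpl; intros h Hh Hlt.
    generalize (Rmin_l del (Rmin t (1 - t))) (Rmin_r del (Rmin t (1 - t)))
      (Rmin_l t (1 - t)) (Rmin_r t (1 - t)); intros.
    assert (Hb := Rabs_def2 _ _ Hlt).
    specialize (Hlim (t + h)); simpl in Hlim; unfold Rdist in Hlim.
    replace (t + h - t) with h in Hlim by ring.
    apply Hlim; unfold D_x, unitI; repeat split; lra.
Qed.

(** The difference between [F] and the primitive of [f] has zero derivative inside
the interval, so the mean value theorem makes it constant. The derivative
is required inside only, because functions extended by [clamp] may have corners at
the endpoints. *)
Lemma is_RInt_interior_derive (F f : R -> R) (a b : R) :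
  a <= b ->
  (forall x, continuous F x) -> (forall x, continuous f x) ->
  (forall x, a < x < b -> is_derive F x (f x)) ->
  is_RInt f a b (F b - F a).
Proof.
  intros Hab CF Cf Hd.
  assert (HI : forall c, is_RInt f a c (RInt f a c)).
  { intros c; apply (RInt_correct (V := R_CompleteNormedModule)).
    apply (ex_RInt_continuous (V := R_CompleteNormedModule)); intros; apply Cf. }
  assert (HdI : forall x, is_derive (fun c => RInt f a c) x (f x)).
  { intros x; apply (is_derive_RInt f _ a x); [|apply Cf].
    apply filter_forall; exact HI. }
  destruct (MVT_gen (fun x => F x - RInt f a x) a b (fun _ => 0)) as [c [_ Hc]].
  - rewrite Rmin_left, Rmax_right by lra; intros x Hx.
    replace 0 with (f x - f x) by ring.
    apply (is_derive_minus F (fun c => RInt f a c)); auto.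
  - intros x _; apply continuity_pt_filterlim.
    apply (continuous_minus F (fun c => RInt f a c)); [apply CF|].
    apply (ex_derive_continuous (V := R_NormedModule)); eexists; apply HdI.
  - replace (F b - F a) with (RInt f a b); [apply HI|].
    rewrite (RInt_point (V := R_CompleteNormedModule)) in Hc.
    change (@zero R_CompleteNormedModule) with 0 in Hc; lra.
Qed.

(** Near a point where [f] is positive it would contribute a positive amount to the
integral. *)
Lemma RInt_eq_0_nonneg (f : R -> R) (a b : R) :
  a < b -> (forall x, continuous f x) -> (forall x, 0 <= f x) ->
  RInt f a b = 0 -> forall x, a <= x <= b -> f x = 0.
Proof.
  intros Hab Cf Pf H0 x Hx.
  destruct (Rle_lt_or_eq_dec _ _ (Pf x)) as [Hpos|]; [exfalso|auto].
  assert (HI : forall c d, ex_RInt f c d).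
  { intros; apply (ex_RInt_continuous (V := R_CompleteNormedModule)); intros; apply Cf. }
  destruct (Cf x (fun y => 0 < y)) as [eps He].
  { exists (mkposreal _ Hpos); intros y Hy.
    apply Rabs_def2 in Hy; simpl in Hy; unfold minus, plus, opp in Hy; simpl in Hy; lra. }
  assert (Heps := cond_pos eps).
  set (c := Rmax a (x - eps)); set (d := Rmin b (x + eps)).
  assert (Hc : a <= c /\ x - eps <= c /\ (c < b)).
  { unfold c; repeat split; [apply Rmax_l|apply Rmax_r|apply Rmax_lub_lt; lra]. }
  assert (Hd : d <= b /\ d <= x + eps /\ c < d).
  { unfold d; repeat split; [apply Rmin_l|apply Rmin_r|].
    apply Rmin_glb_lt; [lra|unfold c; apply Rmax_lub_lt; lra]. }
  assert (H1 := RInt_Chasles f a c b (HI _ _) (HI _ _)).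
  assert (H2 := RInt_Chasles f c d b (HI _ _) (HI _ _)).
  unfold plus in H1, H2; simpl in H1, H2.
  assert (0 <= RInt f a c) by (apply RInt_ge_0; auto; lra).
  assert (0 <= RInt f d b) by (apply RInt_ge_0; auto; lra).
  assert (0 < RInt f c d).
  { apply RInt_gt_0; [lra| |auto].
    intros y Hy; apply He; apply Rabs_def1; unfold minus, plus, opp; simpl; lra. }
  lra.
Qed.

(** This form of a solution, obtained by composing with [clamp], is the one to which
[is_RInt_interior_derive] applies. *)
Lemma is_solution_regular (M d1 d2 : R) (sigma u : R -> R) :
  is_solution M d1 d2 sigma u ->
  exists U dU d2U : R -> R,
    ((forall x, continuous U x) /\ (forall x, continuous dU x) /\
     (forall x, continuous d2U x)) /\
    (forall x, 0 < x < 1 -> is_derive U x (dU x) /\ is_derive dU x (d2U x)) /\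
    (forall t, unitI t -> U t = u t) /\
    (forall t, unitI t -> d2U t + M * U t = sigma t) /\
    U 0 - U 1 = d1 * RInt U 0 1 /\ dU 0 - dU 1 = d2 * RInt U 0 1.
Proof.
  intros [du [d2u [Hd [C2 [Heq [B1 B2]]]]]].
  exists (fun x => u (clamp x)), (fun x => du (clamp x)), (fun x => d2u (clamp x)).
  assert (HI : RInt (fun x => u (clamp x)) 0 1 = RInt u 0 1).
  { apply RInt_ext; intros x; rewrite Rmin_left, Rmax_right by lra; intros Hx.
    rewrite clamp_id; [reflexivity|unfold unitI; lra]. }
  rewrite HI, !(clamp_id 0), !(clamp_id 1) by (unfold unitI; lra).
  split; [|split; [|split; [|split; [|split]]]]; auto.
  - split; [|split]; apply continuous_clamp_comp; auto.
    + apply (D_in_continuous_on u du); intros; apply Hd; auto.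
    + apply (D_in_continuous_on du d2u); intros; apply Hd; auto.
  - split; apply D_in_clamp_is_derive; auto; apply Hd; unfold unitI; lra.
  - intros t Ht; now rewrite clamp_id.
  - intros t Ht; rewrite clamp_id; auto.
Qed.

(** * The explicit Green's function *)

(** Integration by parts, twice: when [p'' = - M p], the bracket [p U' - p' U] is a
primitive of [p (U'' + M U)]. *)
Lemma Lagrange_identity (M a b : R) (p dp U dU d2U : R -> R) :
  a <= b ->
  (forall x, is_derive p x (dp x)) -> (forall x, is_derive dp x (- M * p x)) ->
  (forall x, continuous U x) -> (forall x, continuous dU x) ->
  (forall x, continuous d2U x) ->
  (forall x, a < x < b -> is_derive U x (dU x) /\ is_derive dU x (d2U x)) ->
  is_RInt (fun x => p x * (d2U x + M * U x)) a b
    ((p b * dU b - dp b * U b) - (p a * dU a - dp a * U a)).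
Proof.
  intros Hab Hp Hdp C0 C1 C2 Hd.
  assert (Cp : forall x, continuous p x).
  { intros x; apply (ex_derive_continuous (V := R_NormedModule)); eexists; apply Hp. }
  assert (Cdp : forall x, continuous dp x).
  { intros x; apply (ex_derive_continuous (V := R_NormedModule)); eexists; apply Hdp. }
  apply (is_RInt_interior_derive (fun x => p x * dU x - dp x * U x)); auto.
  - intros x; apply (continuous_minus (fun x => p x * dU x) (fun x => dp x * U x));
      apply (continuous_mult (K := R_AbsRing)); auto.
  - intros x; apply (continuous_mult (K := R_AbsRing)); auto.
    apply (continuous_plus d2U (fun x => M * U x)); auto.
    apply (continuous_scal_r M U); auto.
  - intros x Hx; destruct (Hd x Hx) as [H1 H2].
    replace (p x * (d2U x + M * U x)) with
      ((dp x * dU x + p x * d2U x) - ((- M * p x) * U x + dp x * dU x)) by ring.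
    apply (is_derive_minus (fun x => p x * dU x) (fun x => dp x * U x));
      apply (is_derive_mult (K := R_AbsRing)); auto; exact Rmult_comm.
Qed.

(** The summand with [|t - s|] is the Green's function of the periodic problem. The
other one is the solution [v] of [v'' + m^2 v = 0] with boundary jumps
[v(0) - v(1) = d1 / (m^2 - d2)] and [v'(0) - v'(1) = d2 / (m^2 - d2)]. *)
Definition green (m d1 d2 t s : R) : R :=
  (cos (m * (/ 2 - Rabs (t - s))) +
   (d1 * m * sin (m * (/ 2 - t)) + d2 * cos (m * (/ 2 - t))) / (m ^ 2 - d2))
  / (2 * m * sin (m / 2)).

Lemma continuous_green (m d1 d2 t s : R) : continuous (green m d1 d2 t) s.
Proof.
  apply continuity_pt_filterlim; unfold green.
  unfold Rdiv at 1; apply continuity_pt_mult; [|apply continuity_pt_const; intros ? ?; reflexivity].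
  apply continuity_pt_plus; [|apply continuity_pt_const; intros ? ?; reflexivity].
  apply (continuity_pt_comp (fun s => m * (/ 2 - Rabs (t - s))) cos);
    [|apply continuity_cos].
  apply continuity_pt_mult; [apply continuity_pt_const; intros ? ?; reflexivity|].
  apply continuity_pt_minus; [apply continuity_pt_const; intros ? ?; reflexivity|].
  apply (continuity_pt_comp (fun s => t - s) Rabs); [|apply Rcontinuity_abs].
  apply continuity_pt_minus; [apply continuity_pt_const; intros ? ?; reflexivity|].
  apply continuity_pt_id.
Qed.

(** On each side of the diagonal the kernel is smooth in [s], so Lagrange's identity
applies there. Adding up, the terms with [U' t] cancel and the jump of the derivative
leaves [2 m sin (m/2) U t]. What remains at the endpoints is
[- (d1 m sin th + d2 cos th) S], where [S] is the integral of [U]. The part of the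
kernel that is constant in [s] cancels it, because [sigma] has integral
[(M - d2) S]. *)
Lemma green_represents (M m d1 d2 : R) (sigma u : R -> R) :
  M = m ^ 2 -> m <> 0 -> sin (m / 2) <> 0 -> d2 <> M ->
  is_solution M d1 d2 sigma u ->
  forall t, unitI t -> is_RInt (fun s => green m d1 d2 t s * sigma s) 0 1 (u t).
Proof.
  intros HM Hm Hs Hd2 Hsol t Ht.
  destruct (is_solution_regular _ _ _ _ _ Hsol)
    as [U [dU [d2U [[C0 [C1 C2]] [Hd [HU [Heq [B1 B2]]]]]]]].
  rewrite <- (HU t Ht).
  set (S := RInt U 0 1) in *.
  assert (Hm2 : m ^ 2 - d2 <> 0) by (intros E; apply Hd2; lra).
  assert (HS : is_RInt U 0 1 S).
  { apply (RInt_correct (V := R_CompleteNormedModule)).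
    apply (ex_RInt_continuous (V := R_CompleteNormedModule)); auto. }
  assert (HC : is_RInt (fun x => d2U x + M * U x) 0 1 ((M - d2) * S)).
  { replace ((M - d2) * S) with ((dU 1 - dU 0) + M * S) by lra.
    apply (is_RInt_plus d2U (fun x => M * U x)).
    - apply is_RInt_interior_derive; auto; [lra|]; intros; apply Hd; auto.
    - apply (is_RInt_scal U); exact HS. }
  unfold unitI in Ht.
  set (th := m * (/ 2 - t)).
  set (k := (d1 * m * sin th + d2 * cos th) / (m ^ 2 - d2)).
  assert (HL : is_RInt (fun s => cos (m * (/ 2 - Rabs (t - s))) * (d2U s + M * U s)) 0 t
    ((cos (m / 2) * dU t + m * sin (m / 2) * U t) - (cos th * dU 0 + m * sin th * U 0))).
  { apply (is_RInt_ext (fun s => cos (m * (/ 2 - (t - s))) * (d2U s + M * U s))).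
    { rewrite Rmin_left, Rmax_right by lra; intros s Hs'.
      now rewrite Rabs_right by lra. }
    assert (HL := Lagrange_identity M 0 t (fun s => cos (m * (/ 2 - (t - s))))
      (fun s => - m * sin (m * (/ 2 - (t - s)))) U dU d2U); cbv beta in HL.
    replace (m * (/ 2 - (t - t))) with (m / 2) in HL by field.
    replace (m * (/ 2 - (t - 0))) with th in HL by (unfold th; ring).
    match type of HL with context [is_RInt _ _ _ ?v] => match goal with
      |- is_RInt _ _ _ ?w => replace w with v by ring end end.
    apply HL; auto; try lra; intros.
    - auto_derive; [easy|unfold Rminus; ring].
    - auto_derive; [easy|rewrite HM; unfold Rminus; ring].
    - apply Hd; lra. }
  assert (HR : is_RInt (fun s => cos (m * (/ 2 - Rabs (t - s))) * (d2U s + M * U s)) t 1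
    ((cos th * dU 1 + m * sin th * U 1) - (cos (m / 2) * dU t - m * sin (m / 2) * U t))).
  { apply (is_RInt_ext (fun s => cos (m * (/ 2 - (s - t))) * (d2U s + M * U s))).
    { rewrite Rmin_left, Rmax_right by lra; intros s Hs'.
      rewrite Rabs_left by lra; now replace (- (t - s)) with (s - t) by ring. }
    assert (HR := Lagrange_identity M t 1 (fun s => cos (m * (/ 2 - (s - t))))
      (fun s => m * sin (m * (/ 2 - (s - t)))) U dU d2U); cbv beta in HR.
    replace (m * (/ 2 - (t - t))) with (m / 2) in HR by field.
    replace (m * (/ 2 - (1 - t))) with (- th) in HR by (unfold th; field).
    rewrite cos_neg, sin_neg in HR.
    match type of HR with context [is_RInt _ _ _ ?v] => match goal with
      |- is_RInt _ _ _ ?w => replace w with v by ring end end.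
    apply HR; auto; try lra; intros.
    - auto_derive; [easy|unfold Rminus; ring].
    - auto_derive; [easy|rewrite HM; unfold Rminus; ring].
    - apply Hd; lra. }
  assert (HP := is_RInt_Chasles _ _ _ _ _ _ HL HR).
  assert (HG := is_RInt_scal _ _ _ (/ (2 * m * sin (m / 2))) _
    (is_RInt_plus _ _ _ _ _ _ HP (is_RInt_scal _ _ _ k _ HC))).
  unfold plus, scal in HG; simpl in HG; unfold mult in HG; simpl in HG.
  match type of HG with is_RInt _ _ _ ?v => replace v with (U t) in HG end.
  - apply (is_RInt_ext (V := R_NormedModule)) with (2 := HG).
    rewrite Rmin_left, Rmax_right by lra; intros s Hs'.
    rewrite <- Heq by (unfold unitI; lra).
    (* The equation is stated in the carrier of a normed module, where [field]
       does not recognise it as one between reals. *)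
    unfold green; fold th; fold k; refine (_ : @eq R _ _); field; auto.
  - replace (U 0) with (U 1 + d1 * S) by lra.
    replace (dU 0) with (dU 1 + d2 * S) by lra.
    unfold k; rewrite HM; field; auto.
Qed.

Lemma continuous_on_slice (G : R -> R -> R) (t : R) :
  continuous_on (fun p : R * R => unitI (fst p) /\ unitI (snd p))
    (fun p : R * R => G (fst p) (snd p)) ->
  unitI t -> continuous_on unitI (G t).
Proof.
  intros CG Ht s Hs P HP.
  destruct (CG (t, s) (conj Ht Hs) P HP) as [eps He].
  exists eps; intros y Hy Dy.
  apply (He (t, y)); [split; [apply ball_center|exact Hy]|split; assumption].
Qed.

(** For fixed [t], [G t] and the formula represent [u t] for all right-hand sides;
choosing as right-hand side their difference [w] gives [int w^2 = 0]. *)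
Lemma green_function_unique (M m d1 d2 : R) (G : R -> R -> R) :
  M = m ^ 2 -> m <> 0 -> sin (m / 2) <> 0 -> d2 <> M ->
  is_green_function M d1 d2 G ->
  forall t s, unitI t -> unitI s -> G t s = green m d1 d2 t s.
Proof.
  intros HM Hm Hs Hd2 [CG HG] t s Ht Us.
  set (w := fun x => G t (clamp x) - green m d1 d2 t x).
  assert (CGt : forall x, continuous (fun y => G t (clamp y)) x).
  { apply continuous_clamp_comp, continuous_on_slice; auto. }
  assert (Cw : forall x, continuous w x).
  { intros x; apply (continuous_minus (fun y => G t (clamp y)) (green m d1 d2 t)); auto.
    apply continuous_green. }
  assert (Cww : forall x, continuous (fun y => w y * w y) x).
  { intros x; apply (continuous_mult (K := R_AbsRing)); auto. }
  destruct (HG w (continuous_continuous_on _ _ Cw)) as [Hsol _].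
  assert (Hgreen := green_represents _ _ _ _ _ _ HM Hm Hs Hd2 Hsol t Ht).
  assert (HGw : is_RInt (fun x => G t (clamp x) * w x) 0 1 (RInt (fun x => G t x * w x) 0 1)).
  { rewrite (RInt_ext _ (fun x => G t (clamp x) * w x)).
    - apply (RInt_correct (V := R_CompleteNormedModule)).
      apply (ex_RInt_continuous (V := R_CompleteNormedModule)); intros.
      apply (continuous_mult (K := R_AbsRing)); auto.
    - rewrite Rmin_left, Rmax_right by lra; intros x Hx.
      rewrite clamp_id; [reflexivity|unfold unitI; lra]. }
  assert (H0 : RInt (fun x => w x * w x) 0 1 = 0).
  { apply is_RInt_unique.
    assert (HD := is_RInt_minus _ _ _ _ _ _ HGw Hgreen).
    unfold minus, plus, opp in HD; simpl in HD; rewrite Rplus_opp_r in HD.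
    apply (is_RInt_ext (V := R_NormedModule)) with (2 := HD).
    intros; unfold w; refine (_ : @eq R _ _); ring. }
  assert (Hz : w s * w s = 0).
  { apply (RInt_eq_0_nonneg (fun x => w x * w x) 0 1); auto; [lra|].
    intros; apply Rle_0_sqr. }
  apply Rmult_integral in Hz; unfold w in Hz; rewrite clamp_id in Hz by auto.
  destruct Hz; lra.
Qed.

(** * Positivity as a condition on the diagonal *)

Lemma cos_le_cos_of_abs_le (a x : R) :
  a <= PI -> - a <= x <= a -> cos a <= cos x.
Proof.
  intros Ha Hx; destruct (Rle_dec 0 x).
  - apply cos_decr_1; lra.
  - rewrite <- (cos_neg x); apply cos_decr_1; lra.
Qed.

(** The bracket is the Green's function at [s = t], multiplied by the positive number
[2 m sin (m/2) (m^2 - d2)] and written in the angle [th = m (1/2 - t)]. *)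
Definition diagonal_positive (m d1 d2 : R) : Prop :=
  forall th, - (m / 2) <= th <= m / 2 ->
    0 < (m ^ 2 - d2) * cos (m / 2) + d1 * m * sin th + d2 * cos th.

(** Since [m < PI], the angle [m (1/2 - |t - s|)] stays in [[-m/2, m/2]], where the
cosine is at least [cos (m/2)], with equality for [s = t]. *)
Lemma green_positive_iff (m d1 d2 : R) :
  0 < m < PI -> d2 < m ^ 2 ->
  strictly_positive_on_square (green m d1 d2) <-> diagonal_positive m d1 d2.
Proof.
  intros Hm Hd2.
  assert (Hs : 0 < sin (m / 2)) by (apply sin_gt_0; lra).
  assert (HD : 0 < m ^ 2 - d2) by lra.
  assert (HN : 0 < 2 * m * sin (m / 2)) by (apply Rmult_lt_0_compat; lra).
  split.
  - intros H th Hth.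
    set (t := / 2 - th / m).
    assert (Et : m * (/ 2 - t) = th) by (unfold t; field; lra).
    assert (Ht : unitI t).
    { assert (- (/ 2) <= th / m <= / 2); [|unfold unitI, t; lra].
      split; apply Rmult_le_reg_r with m; try lra; unfold Rdiv;
        rewrite Rmult_assoc, Rinv_l; lra. }
    specialize (H t t Ht Ht); unfold green in H.
    rewrite Et, Rminus_diag, Rabs_R0, Rminus_0_r in H.
    change (m * / 2) with (m / 2) in H.
    apply (Rmult_lt_compat_r ((m ^ 2 - d2) * (2 * m * sin (m / 2)))) in H;
      [|apply Rmult_lt_0_compat; auto].
    rewrite Rmult_0_l in H.
    eapply Rlt_le_trans; [exact H|apply Req_le; field; lra].
  - intros H t s Ht Hs'; unfold unitI in *; unfold green.
    apply Rdiv_lt_0_compat; [|auto].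
    set (th := m * (/ 2 - t)).
    assert (Hth : - (m / 2) <= th <= m / 2).
    { assert (0 <= m * t) by (apply Rmult_le_pos; lra).
      assert (m * t <= m * 1) by (apply Rmult_le_compat_l; lra).
      unfold th; lra. }
    specialize (H th Hth).
    apply Rlt_le_trans with (cos (m / 2) + (d1 * m * sin th + d2 * cos th) / (m ^ 2 - d2)).
    + replace (_ + _) with
        (((m ^ 2 - d2) * cos (m / 2) + d1 * m * sin th + d2 * cos th) / (m ^ 2 - d2))
        by (field; lra).
      apply Rdiv_lt_0_compat; auto.
    + apply Rplus_le_compat_r, cos_le_cos_of_abs_le; [lra|].
      assert (Rabs (t - s) <= 1) by (apply Rabs_le; lra).
      assert (0 <= m * Rabs (t - s)) by (apply Rmult_le_pos; [lra|apply Rabs_pos]).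
      assert (m * Rabs (t - s) <= m * 1) by (apply Rmult_le_compat_l; lra).
      lra.
Qed.

(** * The two regimes of the thresholds *)

Lemma half_angle_signs (m : R) :
  0 < m < PI ->
  0 < sin (m / 2) /\ 0 < cos (m / 2) < 1 /\
  (sin (m / 2)) ^ 2 + (cos (m / 2)) ^ 2 = 1.
Proof.
  intros Hm.
  assert (Hs : 0 < sin (m / 2)) by (apply sin_gt_0; lra).
  assert (Hc : 0 < cos (m / 2)) by (apply cos_gt_0; lra).
  assert (E := sin2_cos2 (m / 2)); unfold Rsqr in E.
  repeat split; try lra; nra.
Qed.

(** At [th = m/2] and [th = - m/2] the terms in [d2] cancel. *)
Lemma diagonal_positive_endpoints (m d1 d2 : R) :
  0 < m < PI -> diagonal_positive m d1 d2 ->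
  Rabs d1 * sin (m / 2) < m * cos (m / 2).
Proof.
  intros Hm H.
  assert (H1 := H (m / 2)); assert (H2 := H (- (m / 2))).
  rewrite cos_neg, sin_neg in H2.
  assert (H1' := H1 ltac:(lra)); assert (H2' := H2 ltac:(lra)).
  apply Rmult_lt_reg_l with m; [lra|].
  unfold Rabs; destruct (Rcase_abs d1); lra.
Qed.

(** That the endpoints suffice comes down to
[sin (m/2) |sin th| + cos (m/2) cos th <= 1], an instance of the addition theorem:
after multiplication by [sin^2 (m/2)], replacing [|d1|] and [d2] by their extreme
values leaves [m^2 cos (m/2)] times the slack in that inequality. *)
Lemma diagonal_positive_iff_endpoints (m d1 d2 : R) :
  0 < m < PI -> k_threshold m < d2 ->
  diagonal_positive m d1 d2 <-> Rabs d1 < m * cot (m / 2).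
Proof.
  intros Hm Hk.
  destruct (half_angle_signs m Hm) as [Hs [Hc E]].
  unfold k_threshold, cot in *.
  assert (Hcot : Rabs d1 < m * (cos (m / 2) / sin (m / 2)) <->
                 Rabs d1 * sin (m / 2) < m * cos (m / 2)).
  { replace (m * (cos (m / 2) / sin (m / 2))) with (m * cos (m / 2) / sin (m / 2))
      by (field; lra).
    symmetry; apply Rlt_div_r; lra. }
  rewrite Hcot; split; [apply diagonal_positive_endpoints; auto|].
  intros Ha th Hth.
  assert (Hk' : - m ^ 2 * (cos (m / 2)) ^ 2 < d2 * (sin (m / 2)) ^ 2).
  { apply (Rmult_lt_compat_r ((sin (m / 2)) ^ 2)) in Hk; [|nra].
    eapply Rle_lt_trans; [|exact Hk]; apply Req_le; field; lra. }
  assert (Hy : cos (m / 2) <= cos th).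
  { apply cos_le_cos_of_abs_le; lra. }
  assert (HA : sin (m / 2) * Rabs (sin th) + cos (m / 2) * cos th <= 1).
  { generalize (COS_bound (m / 2 - th)) (COS_bound (m / 2 + th)).
    rewrite cos_minus, cos_plus.
    unfold Rabs; destruct (Rcase_abs (sin th)); lra. }
  assert (Hx : - (Rabs d1 * Rabs (sin th)) <= d1 * sin th).
  { rewrite <- Rabs_mult; generalize (Rabs_maj2 (d1 * sin th)); lra. }
  assert (Hth1 := sin2_cos2 th); unfold Rsqr in Hth1.
  assert (Px := Rabs_pos (sin th)).
  set (X := Rabs (sin th)) in *.
  assert (HX : X * X = sin th * sin th).
  { unfold X; rewrite <- Rabs_mult; apply Rabs_right; nra. }
  set (s := sin (m / 2)) in *; set (c := cos (m / 2)) in *.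
  set (x := sin th) in *; set (y := cos th) in *; set (a := Rabs d1) in *.
  apply Rmult_lt_reg_l with (s ^ 2); [nra|]; rewrite Rmult_0_r.
  assert (Psm : 0 < s * m) by (apply Rmult_lt_0_compat; lra).
  assert (L0 : s * m * (- (a * s * X)) <= s ^ 2 * m * (d1 * x)).
  { replace (s * m * (- (a * s * X))) with (s ^ 2 * m * (- (a * X))) by ring.
    apply Rmult_le_compat_l; [nra|exact Hx]. }
  assert (L1 : s * m * (a * s * X) <= s * m * (m * c * X)).
  { apply Rmult_le_compat_l; [lra|]; apply Rmult_le_compat_r; lra. }
  assert (Pm : 0 < m ^ 2 * c) by (apply Rmult_lt_0_compat; [apply pow_lt|]; lra).
  assert (L3 : 0 <= m ^ 2 * c * (1 - s * X - c * y)) by (apply Rmult_le_pos; lra).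
  (* Strictness comes from the bound on [d2] inside the interval, and from the
     bound on [d1] at its ends, where the coefficient [y - c] vanishes. *)
  destruct (Rle_lt_or_eq_dec _ _ Hy) as [Hlt|Heq].
  - assert (L2 : (- m ^ 2 * c ^ 2) * (y - c) < d2 * s ^ 2 * (y - c)).
    { apply Rmult_lt_compat_r; lra. }
    replace (s ^ 2 * ((m ^ 2 - d2) * c + d1 * m * x + d2 * y)) with
      (s ^ 2 * m ^ 2 * c + s ^ 2 * m * (d1 * x) + d2 * s ^ 2 * (y - c)) by ring.
    replace (s ^ 2 * m ^ 2 * c) with ((1 - c ^ 2) * (m ^ 2 * c)) by (rewrite <- E; ring).
    lra.
  - assert (HXs : X = s) by nra.
    assert (L1' : s * m * (a * s * X) < s * m * (m * c * X)).
    { apply Rmult_lt_compat_l; [lra|]; apply Rmult_lt_compat_r; lra. }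
    rewrite <- Heq in *; rewrite HXs in *.
    replace (s ^ 2 * ((m ^ 2 - d2) * c + d1 * m * x + d2 * c)) with
      (s * m * (m * c * s) + s ^ 2 * m * (d1 * x)) by ring.
    lra.
Qed.

Lemma sinusoid_sqr (a b th : R) :
  (a * sin th + b * cos th) ^ 2 + (a * cos th - b * sin th) ^ 2 = a ^ 2 + b ^ 2.
Proof.
  transitivity ((a ^ 2 + b ^ 2) * ((sin th)² + (cos th)²)).
  - unfold Rsqr; ring.
  - rewrite sin2_cos2; ring.
Qed.

(** By [sinusoid_sqr] the sinusoid [d1 m sin + d2 cos] has amplitude
[sqrt ((d1 m)^2 + d2^2)], and the right-hand side says that this amplitude is less
than [(m^2 - d2) cos (m/2)], which is plainly sufficient. For necessity, the sinusoid
reaches minus its amplitude at the critical angle [atan (d1 m / d2)], because [d2] is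
negative; the endpoint conditions together with [d2 <= k(M)] place this angle in
[[-m/2, m/2]]. *)
Lemma diagonal_positive_iff_interior (m d1 d2 : R) :
  0 < m < PI -> d2 <= k_threshold m ->
  diagonal_positive m d1 d2 <->
  Rabs d1 < sqrt (- d2 ^ 2 + (cos (m / 2)) ^ 2 * (m ^ 2 - d2) ^ 2) / m.
Proof.
  intros Hm Hk.
  destruct (half_angle_signs m Hm) as [Hs [Hc E]].
  unfold k_threshold, cot in Hk.
  assert (Hk' : d2 * (sin (m / 2)) ^ 2 <= - m ^ 2 * (cos (m / 2)) ^ 2).
  { apply (Rmult_le_compat_r ((sin (m / 2)) ^ 2)) in Hk; [|nra].
    eapply Rle_trans; [exact Hk|]; apply Req_le; field; lra. }
  assert (Pmc : 0 < m ^ 2 * cos (m / 2) ^ 2).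
  { apply Rmult_lt_0_compat; apply pow_lt; lra. }
  assert (Hneg : d2 < 0) by nra.
  set (D := m ^ 2 - d2).
  assert (HD : 0 < D) by (unfold D; nra).
  rewrite <- Rlt_div_r by lra.
  assert (Habs : (Rabs d1 * m) ^ 2 = (d1 * m) ^ 2).
  { rewrite !Rpow_mult_distr, pow2_abs; ring. }
  assert (Pabs : 0 <= Rabs d1 * m) by (apply Rmult_le_pos; [apply Rabs_pos|lra]).
  assert (PcD : 0 < cos (m / 2) * D) by (apply Rmult_lt_0_compat; lra).
  assert (Hsqrt : Rabs d1 * m < sqrt (- d2 ^ 2 + cos (m / 2) ^ 2 * D ^ 2) <->
                  (d1 * m) ^ 2 + d2 ^ 2 < (cos (m / 2) * D) ^ 2).
  { rewrite <- (sqrt_pow2 (Rabs d1 * m)) by auto; rewrite Habs; split; intros H.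
    - apply sqrt_lt_0_alt in H; rewrite Rpow_mult_distr; lra.
    - apply sqrt_lt_1_alt; split; [apply pow2_ge_0|].
      rewrite (Rpow_mult_distr (cos (m / 2))) in H; lra. }
  rewrite Hsqrt; split.
  - intros H.
    assert (Hend := diagonal_positive_endpoints _ _ _ Hm H).
    set (q := d1 * m / d2).
    assert (Hq : Rabs q < tan (m / 2)).
    { unfold q, tan; rewrite Rabs_div, Rabs_mult by lra.
      rewrite (Rabs_right m), (Rabs_left d2) by lra.
      apply (Rlt_div_r _ _ (cos (m / 2))); [lra|].
      replace (Rabs d1 * m / - d2 * cos (m / 2)) with (Rabs d1 * m * cos (m / 2) / - d2)
        by (field; lra).
      apply (Rlt_div_l _ _ (- d2)); [lra|].
      apply Rmult_lt_reg_r with (sin (m / 2)); [auto|].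
      assert (Pmc' : 0 < m * cos (m / 2)) by (apply Rmult_lt_0_compat; lra).
      generalize (Rmult_lt_compat_r _ _ _ Pmc' Hend); lra. }
    assert (Hth : - (m / 2) < atan q < m / 2).
    { apply Rabs_def2 in Hq.
      rewrite <- (atan_tan (m / 2)) by lra.
      rewrite <- atan_opp; split; apply atan_increasing; lra. }
    specialize (H (atan q) ltac:(lra)).
    assert (Pcos : 0 < cos (atan q)) by (apply cos_gt_0; lra).
    assert (Htan := tan_atan q); unfold tan in Htan.
    (* The sinusoid has zero derivative at [atan q]. *)
    assert (Hdir : d1 * m * cos (atan q) = d2 * sin (atan q)).
    { assert (Es : sin (atan q) = q * cos (atan q)).
      { rewrite <- Htan at 2; field; lra. }
      assert (Eq : d2 * q = d1 * m) by (unfold q; field; lra).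
      rewrite Es, <- Eq; ring. }
    assert (E1 := sin2_cos2 (atan q)); unfold Rsqr in E1.
    set (x := sin (atan q)) in *; set (y := cos (atan q)) in *.
    set (z := d1 * m * x + d2 * y).
    assert (Hz : z ^ 2 = (d1 * m) ^ 2 + d2 ^ 2).
    { rewrite <- (sinusoid_sqr _ _ (atan q)); fold x y; fold z.
      rewrite Hdir; ring. }
    assert (Hzy : z * y = d2).
    { transitivity (x * (d1 * m * y) + d2 * y * y); [unfold z; ring|].
      rewrite Hdir; transitivity (d2 * (x * x + y * y)); [ring|rewrite E1; ring]. }
    assert (z < 0) by nra.
    rewrite <- Hz; fold D in H.
    assert (- z < cos (m / 2) * D) by (unfold z; lra).
    nra.
  - intros H th _; fold D.
    set (x := sin th) in *; set (y := cos th) in *.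
    set (z := d1 * m * x + d2 * y).
    assert (Hz : z ^ 2 <= (d1 * m) ^ 2 + d2 ^ 2).
    { rewrite <- (sinusoid_sqr _ _ th); fold x y; fold z.
      generalize (pow2_ge_0 (d1 * m * y - d2 * x)); lra. }
    assert (- z < cos (m / 2) * D) by nra.
    unfold z in *; lra.
Qed.

Theorem theorem5p6 (M m delta1 delta2 : R) (G : R -> R -> R)
  (hm : 0 < m < PI)
  (hM : M = m ^ 2)
  (hdelta2 : g_threshold m < delta2 < M)
  (hG : is_green_function M delta1 delta2 G) :
  (k_threshold m < delta2 < M ->
     (strictly_positive_on_square G <-> Rabs delta1 < m * cot (m / 2))) /\
  (g_threshold m < delta2 <= k_threshold m ->
     (strictly_positive_on_square G <->
      Rabs delta1 <
        sqrt (- delta2 ^ 2 + (cos (m / 2)) ^ 2 * (m ^ 2 - delta2) ^ 2) / m)).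
Proof.
  destruct (half_angle_signs m hm) as [Hs _].
  assert (HG : strictly_positive_on_square G <-> diagonal_positive m delta1 delta2).
  { rewrite <- green_positive_iff by lra.
    assert (E := green_function_unique M m delta1 delta2 G hM
                   ltac:(lra) ltac:(lra) ltac:(lra) hG).
    split; intros H t s Ht Us; specialize (H t s Ht Us).
    - now rewrite <- E.
    - now rewrite E. }
  rewrite HG; split; intros H.
  - apply diagonal_positive_iff_endpoints; tauto.
  - apply diagonal_positive_iff_interior; tauto.
Qed.
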